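(* Let $G=(V,E)$ be an $n$-vertex, $m$-edge undirected graph with maximum degree $\Delta$, and let $I^*$ be a fixed (unknown) maximum independent set of $G$. Suppose we have access to an MIS oracle with persistent noise for $I^*$ with parameter $\varepsilon$. Then there exists a randomized algorithm that, given $G$ and this oracle, runs in $O(m)$ time and outputs an independent set $I$ of $G$ such that, with high probability (i.e., with probability $1-1/\mathrm{poly}(n)$), \[ |I| \geq \frac{\varepsilon}{12}\cdot (\Delta \ln n)^{-1/2}\cdot |I^*|. \]
   Context: An MIS oracle for $I^*$ with parameter $\varepsilon\in(0,1/2]$ is a map $\mathrm{ORC}_{G,I^*}:V\to\{0,1\}$ where $\mathrm{ORC}_{G,I^*}(v)$ is meant to indicate whether $v\in I^*$; for each vertex $v$ the answer is correct with probability $1/2+\varepsilon$ and incorrect with probability $1/2-\varepsilon$, independently across vertices. In the persistent noise setting the randomness is drawn exactly once: each vertex's answer is fixed, so repeated queries to the same vertex return the same answer (equivalently, each vertex can be queried at most once). *)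

(* Defs.v *)
From HB Require Import structures.
From mathcomp Require Import all_boot all_order all_algebra.
From mathcomp Require Import all_classical all_reals all_analysis.

Set Implicit Arguments.
Unset Strict Implicit.
Unset Printing Implicit Defensive.

Import Order.TTheory GRing.Theory Num.Theory.
Local Open Scope ring_scope.

Definition simple_graph n (e : rel 'I_n) : Prop := symmetric e /\ irreflexive e.

Definition edge_set n (e : rel 'I_n) : {set {set 'I_n}} :=
  [set [set uv.1; uv.2] | uv : 'I_n * 'I_n & e uv.1 uv.2].

Definition num_edges n (e : rel 'I_n) : nat := #|edge_set e|.

Definition degree n (e : rel 'I_n) (v : 'I_n) : nat := #|[set u | e v u]|.

Definition max_degree n (e : rel 'I_n) : nat := (\max_(v < n) degree e v)%N.

Definition independent n (e : rel 'I_n) (I : {set 'I_n}) : bool :=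
  [forall u in I, forall v in I, ~~ e u v].

Definition maximum_independent n (e : rel 'I_n) (I : {set 'I_n}) : Prop :=
  independent e I /\
  forall J : {set 'I_n}, independent e J -> (#|J| <= #|I|)%N.

(* Every undirected edge occurs exactly once in [es], in an arbitrary position
   and with an arbitrary orientation. *)
Definition edge_listing n (e : rel 'I_n) (es : seq ('I_n * 'I_n)) : bool :=
  perm_eq [seq [set uv.1; uv.2] | uv <- es] (enum (edge_set e)).

(* The computation model is a real RAM: natural-number registers and arrays,
   and real registers with exact field arithmetic and comparison (needed
   because eps is an arbitrary real).  Every instruction and every evaluation
   of a test takes one unit of time.  The only arithmetic on naturals is the
   increment and there is no conversion from reals to naturals, so after t
   steps every natural stored exceeds the largest one in the input and in the
   program text by at most t: words keep O(log(n + t)) bits. *)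

Inductive real_op : Type := RAdd | RSub | RMul | RDiv.

Inductive ram_test : Type :=
| NatEq of nat & nat
| NatLt of nat & nat
| RealLe of nat & nat.

Inductive instr : Type :=
| Const of nat & nat                     (* x := literal c *)
| Move of nat & nat                      (* x := y *)
| Incr of nat                            (* x := x + 1 *)
| Read of nat & nat & nat                (* x := A_a[i] *)
| Write of nat & nat & nat               (* A_a[i] := x *)
| Query of nat & nat                     (* x := ORC(v) *)
| Flip of nat                            (* x := fair random bit *)
| Cast of nat & nat                      (* real r := natural x *)
| RealOp of real_op & nat & nat & nat    (* real r := real s op real t *)
| If of ram_test & seq instr & seq instr
| While of ram_test & seq instr.

Definition program := seq instr.

Record state (R : Type) := State {
  nreg : nat -> nat;
  mem : nat -> nat -> nat;
  rreg : nat -> R;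
  coins : seq bool
}.

Definition update (T : Type) (f : nat -> T) (i : nat) (x : T) : nat -> T :=
  fun j => if j == i then x else f j.

Section Machine.

Variable R : realFieldType.
Implicit Type s : state R.

Definition set_nreg s x c :=
  State (update (nreg s) x c) (mem s) (rreg s) (coins s).

Definition set_mem s a i c :=
  State (nreg s) (update (mem s) a (update (mem s a) i c)) (rreg s) (coins s).

Definition set_rreg s r c :=
  State (nreg s) (mem s) (update (rreg s) r c) (coins s).

Definition eval_op (o : real_op) (x y : R) : R :=
  match o with
  | RAdd => x + y
  | RSub => x - y
  | RMul => x * y
  | RDiv => x / y
  end.

Definition eval_test (t : ram_test) s : bool :=
  match t with
  | NatEq x y => nreg s x == nreg s y
  | NatLt x y => (nreg s x < nreg s y)%N
  | RealLe x y => rreg s x <= rreg s y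
  end.

(* A configuration is the list of instructions still to be executed, together
   with a state.  [orc] is the (already drawn, hence persistent) table of
   oracle answers. *)
Definition step (orc : nat -> bool) (c : program * state R) :
    program * state R :=
  let: (p, s) := c in
  if p is i :: k then
    match i with
    | Const x c => (k, set_nreg s x c)
    | Move x y => (k, set_nreg s x (nreg s y))
    | Incr x => (k, set_nreg s x (nreg s x).+1)
    | Read x a i => (k, set_nreg s x (mem s a (nreg s i)))
    | Write a i x => (k, set_mem s a (nreg s i) (nreg s x))
    | Query x v => (k, set_nreg s x (orc (nreg s v)))
    | Flip x =>
        (k, State (update (nreg s) x (head false (coins s) : nat)) (mem s)
              (rreg s) (behead (coins s)))
    | Cast r x => (k, set_rreg s r (nreg s x)%:R)
    | RealOp o r x y => (k, set_rreg s r (eval_op o (rreg s x) (rreg s y)))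
    | If t p1 p2 => ((if eval_test t s then p1 else p2) ++ k, s)
    | While t q => (if eval_test t s then q ++ p else k, s)
    end
  else c.

(* Input: n in natural register 0, the number of edges in natural register 1,
   the two endpoints of the i-th edge in A_0[i] and A_1[i], and eps in real
   register 0; everything else is 0. *)
Definition init_state n (es : seq ('I_n * 'I_n)) (eps : R) (r : seq bool) :
    state R :=
  State
    (fun x => match x with 0 => n | 1 => size es | _ => 0 end)%N
    (fun a i => match a with
                | 0 => nth 0 [seq val uv.1 | uv <- es] i
                | 1 => nth 0 [seq val uv.2 | uv <- es] i
                | _ => 0
                end)%N
    (fun x => if x == 0%N then eps else 0)
    r.

Definition oracle_table n (a : {ffun 'I_n -> bool}) (v : nat) : bool :=
  if insub v is Some i then a i else false.

Definition run (p : program) n (es : seq ('I_n * 'I_n)) (eps : R)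
    (a : {ffun 'I_n -> bool}) (r : seq bool) (T : nat) : program * state R :=
  iter T (step (oracle_table a)) (p, init_state es eps r).

Definition halted (c : program * state R) : bool := nilp c.1.

(* The array A_2 flags the vertices removed from V; it is initially 0.  This
   encoding of the output allows a running time that is O(m) even when most
   vertices are isolated, in which case I cannot be written down explicitly. *)
Definition output n (c : program * state R) : {set 'I_n} :=
  [set v : 'I_n | mem c.2 2 v == 0%N].

(* Joint law of the oracle answers, independent across vertices and each
   correct with probability 1/2 + eps, and of T independent fair coins. *)
Definition oracle_law n (Istar : {set 'I_n}) (eps : R)
    (a : {ffun 'I_n -> bool}) : R :=
  \prod_(v < n) (if a v == (v \in Istar) then 1 / 2 + eps else 1 / 2 - eps).

Definition Prob n (Istar : {set 'I_n}) (eps : R) T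
    (E : {ffun 'I_n -> bool} -> T.-tuple bool -> bool) : R :=
  \sum_(a : {ffun 'I_n -> bool}) \sum_(r : T.-tuple bool | E a r)
    oracle_law Istar eps a * (1 / 2) ^+ T.

End Machine.

Arguments output {R} n c.

(* Main.v *)
Require Import Defs.
From mathcomp Require Import all_boot all_order all_algebra.
From mathcomp Require Import all_classical all_reals all_analysis.
From mathcomp Require Import zify ring lra.

(* Each vertex v computes the score w of its d oracle answers on its
   neighbours, counted as +1 or -1, recentred by 2 eps d so that the mean of w
   is 4 eps times the number of neighbours of v in I*.  Let L be of order ln n.
   By a Chernoff bound, with probability 1 - 1/n every score is within
   sqrt(d L) of its mean; so selecting the vertices with w <= sqrt(d L) keeps
   all of I*, and a selected vertex outside I* has at most sqrt(d L) / (2 eps)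
   neighbours in I*.  Any maximal independent subset J of the selected vertices
   dominates I*, and each vertex of J accounts for at most
   12 sqrt(Delta ln n) / eps vertices of I*.

   The machine has no logarithm and cannot afford ln n steps when n is huge
   compared with m.  It takes L = 48 (floor(log2 m) + 1), which is of order ln n
   when n < 4m.  When n >= 4m, at least half of the vertices are isolated;
   these are always kept, and the bound holds with certainty. *)

Import Order.TTheory GRing.Theory Num.Theory.
Set Implicit Arguments.
Unset Strict Implicit.
Unset Printing Implicit Defensive.
Local Open Scope ring_scope.

Local Notation arr := Defs.mem.

Lemma update_eq T (f : nat -> T) i c : update f i c i = c.
Proof. by rewrite /update eqxx. Qed.

Lemma update_neq T (f : nat -> T) i c j : j != i -> update f i c j = f j.
Proof. by rewrite /update => /negbTE->. Qed.

(** * Total correctness with running time *)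

Section Machine.
Variables (R : realFieldType) (orc : nat -> bool).
Implicit Types (p q : program) (s : state R).

(** The run has to be the same in front of every continuation [k], which makes the predicate compose
    along [++]. The postcondition sees the exact number of steps, so a specification also bounds the
    time. *)
Definition wp p s (Q : nat -> state R -> Prop) : Prop :=
  exists t s', (forall k, iter t (step orc) (p ++ k, s) = (k, s')) /\ Q t s'.

Lemma wp_nil s Q : Q 0 s -> wp [::] s Q.
Proof. by exists 0, s. Qed.

Lemma wp_step i p s (Q : nat -> state R -> Prop) :
  let c := step orc (i :: p, s) in
  wp c.1 c.2 (fun t => Q t.+1) -> wp (i :: p) s Q.
Proof.
move=> c [t [s' [run Qs']]]; exists t.+1, s'; split=> // k.
rewrite iterSr -run /c; congr iter.
by case: i {c run} => //= [b p1 p2|b p1]; case: ifP; rewrite -?catA.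
Qed.

Lemma wp_cat p q s Q :
  wp p s (fun t1 s1 => wp q s1 (fun t2 => Q (t1 + t2)%N)) -> wp (p ++ q) s Q.
Proof.
move=> [t1 [s1 [run1 [t2 [s2 [run2 Qs2]]]]]]; exists (t1 + t2)%N, s2.
by split=> // k; rewrite -catA addnC iterD run1 run2.
Qed.

Lemma wp_imp p s (Q Q' : nat -> state R -> Prop) :
  wp p s Q -> (forall t s', Q t s' -> Q' t s') -> wp p s Q'.
Proof. by move=> [t [s' [run Qs']]] QQ'; exists t, s'; split=> //; apply: QQ'. Qed.

(** A loop whose number [N] of rounds is known beforehand. Each round pays one extra step for its
    test, and the last, failing test accounts for [t0.+1]. *)
Lemma wp_for b q N (Inv : nat -> nat -> state R -> Prop) s :
  Inv 0 0 s ->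
  (forall i t s, (i < N)%N -> Inv i t s ->
     eval_test b s /\ wp q s (fun t' => Inv i.+1 (t + t').+1)) ->
  (forall t s, Inv N t s -> ~~ eval_test b s) ->
  wp [:: While b q] s (fun t s' => exists2 t0, t = t0.+1 & Inv N t0 s').
Proof.
move=> Inv0 InvS InvN.
have loop j i t s1 : (i + j = N)%N -> Inv i t s1 ->
    wp [:: While b q] s1
       (fun t' s' => exists2 t0, (t + t' = t0.+1)%N & Inv N t0 s').
  elim: j i t s1 => [|j IHj] i t s1.
    rewrite addn0 => -> Hs1; apply: wp_step => /=.
    by rewrite (negbTE (InvN _ _ Hs1)); apply: wp_nil; exists t; rewrite ?addn1.
  move=> ijN Hs1; have [|b1 wq] := InvS i t s1 _ Hs1; first by lia.
  apply: wp_step => /=; rewrite b1; apply: wp_cat; apply: wp_imp wq _ => t1 s2 Hs2.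
  have ijN' : (i.+1 + j = N)%N by lia.
  apply: wp_imp (IHj _ _ _ ijN' Hs2) _ => t2 s3 [t0 t0E Hs3]; exists t0 => //; lia.
by have := loop N 0%N 0%N s (add0n N) Inv0.
Qed.

End Machine.

(** * The algorithm *)

(* Natural registers: 1 = m, 4 = the constant 0, 5 = the constant 1, 6 = current
   edge, 7 = number of list cells in use, 2 and 3 = endpoints, 8 and 9 scratch.
   Real registers: 0 = eps, 1 = the constant 0, 2 = L, the others scratch.
   Arrays: 3 and 4 = numbers of positive and negative answers among the
   neighbours, 5 = head of the adjacency list (0 for the empty list), 6 = next
   cell, 7 = vertex stored in a cell. *)
Definition prelude : program :=
  [:: Const 5 1; Const 8 48; Cast 3 5; Cast 4 1; Cast 5 8;
      While (RealLe 3 4) [:: RealOp RAdd 3 3 3; RealOp RAdd 2 2 5]].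

(** The cell counter is incremented before use, so cells are numbered from 1 and 0 is free to mean
    the empty list. As the arrays start at 0, all lists are empty at no cost. *)
Definition record_dart : program :=
  [:: Query 8 3;
      If (NatEq 8 4) [:: Read 8 4 2; Incr 8; Write 4 2 8]
                     [:: Read 8 3 2; Incr 8; Write 3 2 8];
      Incr 7; Write 7 7 3; Read 8 5 2; Write 6 7 8; Write 5 2 7].

Definition record_edges : program :=
  [:: While (NatLt 6 1)
     ([:: Read 2 0 6; Read 3 1 6] ++ record_dart ++
      [:: Read 2 1 6; Read 3 0 6] ++ record_dart ++ [:: Incr 6])].

Definition discard_nbrs : program :=
  [:: Read 8 5 2; Write 5 2 4;
      While (NatLt 4 8) [:: Read 9 7 8; Write 2 9 5; Read 8 6 8]].

(** Without a square root, [w <= sqrt (d L)] is tested as [w ^ 2 <= d L], after a nonpositive [w]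
    has been replaced by 0. *)
Definition weigh : program :=
  [:: Read 8 3 2; Cast 3 8; Read 8 4 2; Cast 4 8;
      RealOp RAdd 5 3 4; RealOp RSub 3 3 4; RealOp RMul 4 5 0;
      RealOp RAdd 3 3 4; RealOp RAdd 3 3 4;
      If (RealLe 3 1) [:: RealOp RMul 3 3 1] [::];
      RealOp RMul 3 3 3; RealOp RMul 5 5 2].

Definition visit : program :=
  [:: Read 8 2 2;
      If (NatEq 8 4)
        (weigh ++ [:: If (RealLe 3 5) discard_nbrs [:: Write 2 2 5]])
        [::]].

(** The vertices are reached through the edges to keep the time O(m). Isolated vertices are never
    visited and keep the flag 0. *)
Definition visit_edges : program :=
  [:: Const 6 0;
      While (NatLt 6 1)
        ([:: Read 2 0 6] ++ visit ++ [:: Read 2 1 6] ++ visit ++ [:: Incr 6])].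

Definition prog : program := prelude ++ record_edges ++ visit_edges.

(** * Correctness of the algorithm *)

Section Correct.
Variables (R : realFieldType) (orc : nat -> bool) (n : nat).
Variables (es : seq ('I_n * 'I_n)) (eps : R).
Implicit Types (D : seq (nat * nat)) (s : state R).

Local Notation m := (size es).
Local Notation init := (init_state es eps).
Local Notation wp := (wp orc).

Definition log_weight : R := 48 * (trunc_log 2 m).+1%:R.

(** Recording prepends to the lists, so the dart recorded last comes first; hence the order within
    an edge, and [rev] wherever this is used. *)
Definition darts (es' : seq ('I_n * 'I_n)) : seq (nat * nat) :=
  flatten [seq [:: (val uv.2, val uv.1); (val uv.1, val uv.2)] | uv <- es'].

Definition nbrs D x := [seq d.2 | d <- D & d.1 == x].

Definition const_regs s :=
  [/\ nreg s 1 = m, nreg s 4 = 0%N & nreg s 5 = 1%N] /\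
  [/\ rreg s 0 = eps, rreg s 1 = 0 & rreg s 2 = log_weight].

Lemma prelude_spec r : (0 < m)%N ->
  wp prelude (init r) (fun t s =>
    [/\ (t <= 3 * m + 9)%N, const_regs s, nreg s 6 = 0%N, nreg s 7 = 0%N &
        arr s = arr (init r)]).
Proof.
move=> m_gt0; do 5!apply: wp_step => /=.
set s0 := set_rreg _ _ _.
pose Inv i t s := [/\ t = (3 * i)%N,
  nreg s = nreg s0 /\ arr s = arr s0,
  [/\ rreg s 0 = eps, rreg s 1 = 0 & rreg s 2 = 48 * i%:R] &
  [/\ rreg s 3 = (2 ^ i)%:R, rreg s 4 = m%:R & rreg s 5 = 48]].
have: wp [:: While (RealLe 3 4) [:: RealOp RAdd 3 3 3; RealOp RAdd 2 2 5]] s0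
    (fun t s => exists2 t0, t = t0.+1 & Inv (trunc_log 2 m).+1 t0 s).
  apply: wp_for => [|i t s ltiN [-> [nE mE] [r0 r1 r2] [r3 r4 r5]]|t s [_ _ _ [r3 r4 _]]].
  - by rewrite /Inv /= /update /= mulr0.
  - rewrite /= r3 r4 ler_nat; split.
      by apply: leq_trans (trunc_logP (isT : 1 < 2)%N m_gt0); rewrite leq_exp2l.
    do 2!apply: wp_step => /=; apply: wp_nil; rewrite /Inv /= /update /=.
    split; [lia | by [] | | ]; split=> //.
      by rewrite r2 r5 -[i.+1]addn1 natrD mulrDr mulr1.
    by rewrite r3 -natrD addnn -mul2n expnS.
  - by rewrite /= r3 r4 ler_nat -ltnNge trunc_log_ltn.
move=> w; apply: wp_imp w _ => t s [t0 -> [-> [nE mE] [r0 r1 r2] _]].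
rewrite /const_regs nE mE; split=> //.
(* The time is [3 * (log + 1) + 6], and [log < 2 ^ log <= m]. *)
have := trunc_logP (isT : 1 < 2)%N m_gt0; have := ltn_expl (trunc_log 2 m) (isT : 1 < 2)%N.
lia.
Qed.

(** * Adjacency lists and the recording phase *)

Fixpoint linked (next elt : nat -> nat) (c h : nat) (l : seq nat) : Prop :=
  if l is w :: l' then
    [/\ (0 < h <= c)%N, elt h = w & linked next elt c (next h) l']
  else h = 0%N.

(** The cells of a recorded list are at most [c], so filling the fresh cell [c.+1] does not disturb
    it. *)
Lemma linked_update next elt c h l y z :
  linked next elt c h l ->
  linked (update next c.+1 z) (update elt c.+1 y) c.+1 h l.
Proof.
elim: l h => //= w l IHl h [/andP[h_gt0 le_hc] eltE lnk].
have neq_h : (h == c.+1) = false by apply/eqP; lia.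
by rewrite /update neq_h; split=> //; [rewrite h_gt0 leqW | apply: IHl].
Qed.

Definition recorded D s :=
  [/\ const_regs s,
      [/\ arr s 0 = arr (init [::]) 0, arr s 1 = arr (init [::]) 1 &
          forall x, arr s 2 x = 0%N],
      forall x, arr s 3 x = count orc (nbrs D x) /\
                arr s 4 x = count (predC orc) (nbrs D x) &
      forall x, linked (arr s 6) (arr s 7) (nreg s 7) (arr s 5 x) (nbrs D x)].

Lemma record_dart_spec D s x y :
  recorded D s -> nreg s 2 = x -> nreg s 3 = y ->
  wp record_dart s (fun t s' =>
    [/\ t = 10%N, recorded ((x, y) :: D) s' & nreg s' 6 = nreg s 6]).
Proof.
case: s => nr me rr co; rewrite /recorded /const_regs /=.
move=> [[[r1 r4 r5] rrs] [a0 a1 a2] cnt lnk] r2 r3.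
have lnk' z : linked (update (me 6) (nr 7).+1 (me 5 x)) (update (me 7) (nr 7).+1 y)
    (nr 7).+1 (update (me 5) x (nr 7).+1 z) (nbrs ((x, y) :: D) z).
  rewrite /nbrs /=; case: eqVneq => [->|neq_zx] /=.
    by rewrite !update_eq ltn0Sn leqnn; split=> //; apply: linked_update.
  by rewrite (update_neq (me 5)) 1?eq_sym //; apply: linked_update.
do 2!apply: wp_step => /=; rewrite /update /= r3 r4.
(* Both branches consist of three instructions, hence the exact time 10. *)
case: (boolP (orc y)) => orcy; apply: wp_cat.
all: do 3!apply: wp_step => /=; apply: wp_nil.
all: do 5!apply: wp_step => /=; apply: wp_nil.
all: rewrite /recorded /const_regs /= /update /= ?r1 ?r2 ?r3 ?r4 ?r5.
all: split=> //; split=> // z; have [cnt3 cnt4] := cnt z.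
all: rewrite /nbrs /= [z == x]eq_sym.
all: case: eqVneq => [->|_] //=.
all: rewrite ?(negbTE orcy) ?orcy /= ?cnt3 ?cnt4 ?add0n ?add1n //.
Qed.

Opaque record_dart.

Lemma recorded_set_nreg D s i c : (i \in [:: 2; 3; 6])%N ->
  recorded D s -> recorded D (set_nreg s i c).
Proof. by case: s => nr me rr co; rewrite !inE => /or3P[]/eqP->. Qed.

Lemma edge_at i : (i < m)%N -> exists uv,
  [/\ uv \in es, rev (take i.+1 es) = uv :: rev (take i es),
      arr (init [::]) 0 i = uv.1 & arr (init [::]) 1 i = uv.2].
Proof.
move=> lti; have [uv0 _]: exists uv0, uv0 \in es.
  by case: (es) lti => [|uv0 es' _] //; exists uv0; rewrite mem_head.
exists (nth uv0 es i); rewrite mem_nth //; split=> //.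
- by rewrite (take_nth uv0) // rev_rcons.
- by rewrite /= (nth_map uv0).
- by rewrite /= (nth_map uv0).
Qed.

Lemma record_edges_spec s :
  const_regs s -> nreg s 6 = 0%N -> nreg s 7 = 0%N -> arr s = arr (init [::]) ->
  wp record_edges s (fun t s' =>
    t = (26 * m).+1 /\ recorded (darts (rev es)) s').
Proof.
move=> regs r6 r7 mE.
(* 26 is one test, four reads, two recordings of 10 steps each and one increment. *)
pose Inv i t s :=
  [/\ t = (26 * i)%N, recorded (darts (rev (take i es))) s & nreg s 6 = i].
have: wp record_edges s (fun t s' => exists2 t0, t = t0.+1 & Inv m t0 s').
  apply: wp_for => [|i t s1 ltim [-> rec1 r6i]|t s1 [_ [[[r1 _ _] _] _ _ _] r6i]].
  - by rewrite /Inv take0 /recorded mE.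
  - have [[[r1 _ _] _] _ _ _] := rec1.
    rewrite /= r1 r6i; split=> //.
    have [[u v] /= [_ takeE a0 a1]] := edge_at ltim.
    do 2!apply: wp_step => /=; apply: wp_cat.
    have rec2 : recorded (darts (rev (take i es)))
        (set_nreg (set_nreg s1 2 (arr s1 0 (nreg s1 6))) 3
          (arr s1 1 (update (nreg s1) 2 (arr s1 0 (nreg s1 6)) 6))).
      by do 2!apply: recorded_set_nreg => //.
    have [_ [A0 A1 _] _ _] := rec1.
    apply: wp_imp (record_dart_spec (x := u) (y := v) rec2 _ _) _;
      rewrite /= /update /= ?A0 ?A1 ?r6i // => t2 s2 [-> rec3 r6'].
    do 2!apply: wp_step => /=; apply: wp_cat.
    have [_ [A0' A1' _] _ _] := rec3.
    set s2' := set_nreg _ 3 _.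
    have rec3' : recorded ((val u, val v) :: darts (rev (take i es))) s2'.
      by do 2!apply: recorded_set_nreg => //.
    apply: wp_imp (record_dart_spec (x := v) (y := u) rec3' _ _) _;
      rewrite /= /update /= ?A0' ?A1' ?r6' ?r6i // => t3 s3 [-> rec4 r6''].
    apply: wp_step => /=; apply: wp_nil.
    split; [lia| |by rewrite /= /update /= r6''].
    by rewrite takeE; apply: recorded_set_nreg.
  - by rewrite /= r1 r6i ltnn.
by move=> w; apply: wp_imp w _ => t s' [t0 -> [-> + _]]; rewrite take_size.
Qed.

(** * The selection phase *)

Definition frame s s' :=
  [/\ forall i, (i \in [:: 1; 4; 5; 6])%N -> nreg s' i = nreg s i,
      forall i, (i \in [:: 0; 1; 2])%N -> rreg s' i = rreg s i &
      forall a, (a \in [:: 0; 1; 3; 4; 6; 7])%N -> arr s' a = arr s a].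

Lemma frame_trans s1 s2 s3 : frame s1 s2 -> frame s2 s3 -> frame s1 s3.
Proof.
move=> [n1 r1 a1] [n2 r2 a2]; split=> i iin; first by rewrite n2 ?n1.
  by rewrite r2 ?r1.
by rewrite a2 ?a1.
Qed.

Lemma frame_const_regs s s' : frame s s' -> const_regs s -> const_regs s'.
Proof.
by move=> [fn fr _] [[r1 r4 r5] [q0 q1 q2]]; rewrite /const_regs !fn ?fr.
Qed.

Definition flag_nbrs := While (NatLt 4 8) [:: Read 9 7 8; Write 2 9 5; Read 8 6 8].

(** Induction on the list: each cell costs one test and three instructions, and the final test one
    more step. *)
Lemma flag_nbrs_spec s c l :
  linked (arr s 6) (arr s 7) c (nreg s 8) l -> nreg s 4 = 0%N -> nreg s 5 = 1%N ->
  wp [:: flag_nbrs] s (fun t s' =>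
    [/\ t = (4 * size l).+1, frame s s', arr s' 5 = arr s 5 &
        forall z, arr s' 2 z = if z \in l then 1%N else arr s 2 z]).
Proof.
elim: l s => [|w l IHl] s /= lnk r4 r5.
  apply: wp_step => /=; rewrite r4 lnk ltnn; by apply: wp_nil; split.
have [/andP[h_gt0 _] toE lnk'] := lnk.
apply: wp_step => /=; rewrite r4 h_gt0.
do 3!apply: wp_step => /=.
set s1 := set_nreg _ 8 _.
have lnk1 : linked (arr s1 6) (arr s1 7) c (nreg s1 8) l.
  by rewrite /s1 /= /update /=.
apply: wp_imp (IHl s1 lnk1 _ _) _; rewrite ?/s1 /= /update //= => t s' [-> fr a5 a2].
split=> //; first by lia.
  apply: frame_trans fr; split=> i; rewrite !inE //=.
    by case/or4P => /eqP->.
  by rewrite /update; case: i => [|[|[|]]].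
move=> z; rewrite a2 /update /= in_cons toE r5.
by case: ifP; rewrite ?orbT // orbF; case: ifP.
Qed.

Lemma discard_nbrs_spec s c l :
  linked (arr s 6) (arr s 7) c (arr s 5 (nreg s 2)) l ->
  nreg s 4 = 0%N -> nreg s 5 = 1%N ->
  wp discard_nbrs s (fun t s' =>
    [/\ t = (4 * size l).+3, frame s s',
        arr s' 5 = update (arr s 5) (nreg s 2) 0%N &
        forall z, arr s' 2 z = if z \in l then 1%N else arr s 2 z]).
Proof.
move=> lnk r4 r5; do 2!apply: wp_step => /=.
apply: wp_imp (flag_nbrs_spec (c := c) (l := l) _ _ _) _; rewrite /= /update /= ?r4 //.
move=> t s' [-> fr a5 a2]; split=> //.
apply: frame_trans fr; split=> i; rewrite !inE //=.
  by case/or4P => /eqP->.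
by rewrite /update; case: i => [|[|[|[|[|[|]]]]]].
Qed.

Opaque discard_nbrs.

Definition passes D x : bool :=
  let yes := (count orc (nbrs D x))%:R : R in
  let no := (count (predC orc) (nbrs D x))%:R in
  let w := yes - no + (yes + no) * eps + (yes + no) * eps in
  (w <= 0) || (w * w <= (yes + no) * log_weight).

(* [C] is the set of vertices already chosen; the adjacency list of a chosen
   vertex is emptied, so that visiting it again costs O(1). *)
Definition selected D (C : seq nat) s :=
  [/\ const_regs s,
      [/\ arr s 0 = arr (init [::]) 0, arr s 1 = arr (init [::]) 1 &
          forall x, arr s 3 x = count orc (nbrs D x) /\
                    arr s 4 x = count (predC orc) (nbrs D x)],
      exists c, forall x, linked (arr s 6) (arr s 7) c (arr s 5 x)
                            (if x \in C then [::] else nbrs D x),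
      (forall x, x \in C ->
        [/\ arr s 2 x = 0%N, passes D x &
            forall y : nat, y \in nbrs D x -> arr s 2 y != 0%N]) &
      (forall x, arr s 2 x != 0%N ->
        ~~ passes D x \/ exists2 y, y \in C & x \in nbrs D y)].

(** A chosen vertex has flag 0, just as one not yet reached, so the flags alone do not tell which
    vertices are settled. *)
Definition visited (C : seq nat) s x := (arr s 2 x != 0%N) || (x \in C).

Lemma log_weight_ge0 : 0 <= log_weight.
Proof. by rewrite mulr_ge0 ?ler0n. Qed.

Definition total_degree D C := (\sum_(x <- C) size (nbrs D x))%N.

Lemma weigh_spec D s : const_regs s ->
  (forall x, arr s 3 x = count orc (nbrs D x) /\
             arr s 4 x = count (predC orc) (nbrs D x)) ->
  wp weigh s (fun t s' =>
    [/\ (t <= 13)%N, frame s s', arr s' = arr s, nreg s' 2 = nreg s 2 &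
        (rreg s' 3 <= rreg s' 5) = passes D (nreg s 2)]).
Proof.
case: s => nr me rr co [_ [/= q0 q1 q2]] cnt; have [cnt3 cnt4] := cnt (nr 2).
do 10!apply: wp_step => /=; rewrite /update /= q0 q1 cnt3 cnt4.
case: ifP => w_le0 /=.
all: do ?[apply: wp_step => /=]; apply: wp_nil; rewrite /= /update /= ?q1 ?q2.
all: split=> //; try by split=> i; rewrite !inE /=; case: i => [|[|[|[|[|[|[|]]]]]]].
  by rewrite mulr0 mulr0 /passes w_le0 /= mulr_ge0 ?log_weight_ge0.
by rewrite /passes w_le0.
Qed.

Opaque weigh.

(** Amortised cost with potential [4 * total_degree D C]: traversing the list of a newly chosen
    vertex costs 4 steps per cell, paid by the growth of the potential. The remaining 19 steps are 2
    to read and test the flag, at most 13 for [weigh], 1 for the comparison and 3 around the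
    traversal. *)
Lemma visit_spec D C s :
  (forall x y, (x \in nbrs D y) = (y \in nbrs D x)) ->
  (forall x, x \notin nbrs D x) ->
  uniq C -> selected D C s ->
  wp visit s (fun t s' => exists C',
    [/\ (t + 4 * total_degree D C <= 19 + 4 * total_degree D C')%N,
        uniq C', selected D C' s', nreg s' 6 = nreg s 6 &
        visited C' s' (nreg s 2) /\
        forall z, visited C s z -> visited C' s' z]).
Proof.
move=> nsym nirr uC [regs [a0 a1 cnt] [c lnk] inC flg].
have [[r1 r4 r5] [q0 q1 q2]] := regs.
do 2!apply: wp_step => /=; rewrite /update /= r4.
set s1 := set_nreg s 8 _.
have fr1 : frame s s1.
  by split=> // i; rewrite !inE => /or4P[]/eqP->; rewrite /s1 /= /update.
case: ifPn => [/eqP fx|fx] /=; last first.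
  apply: wp_nil; exists C; split=> //; first by lia.
    by split=> //; exists c.
  by rewrite /visited fx.
have regs1 := frame_const_regs fr1 regs.
rewrite cats0; apply: wp_cat; apply: wp_imp (weigh_spec (s := s1) regs1 cnt) _.
move=> t2 s2 [t2_le fr2 a2 x2 testE].
have {x2} x2 : nreg s2 2 = nreg s 2 by rewrite x2.
have {}a2 : arr s2 = arr s by rewrite a2.
have {}testE : (rreg s2 3 <= rreg s2 5) = passes D (nreg s 2) by rewrite testE.
have regs2 := frame_const_regs (frame_trans fr1 fr2) regs.
have n62 : nreg s2 6 = nreg s 6 by have [fn _ _] := fr2; rewrite fn.
have [[_ r42 r52] _] := regs2.
move: (nreg s 2) fx x2 testE => x fx x2 testE.
apply: wp_step; rewrite /= testE.
case: ifPn => px /=; last first.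
  apply: wp_step => /=; apply: wp_nil; exists C; rewrite r52 x2.
  have mono z : arr s 2 z != 0%N -> update (arr s 2) x 1%N z != 0%N.
    by rewrite /update; case: (z == x).
  split=> //; first by lia.
    split; rewrite /= ?a2 /update //=; first by exists c.
      move=> y yC; have [fy py fny] := inC y yC; split=> //.
        by case: eqP => // yx; rewrite -yx py in px.
      by move=> z /fny; apply: mono.
    by move=> y; case: (eqVneq y x) => [-> _|_ /flg]; first by left.
  rewrite /visited /= a2 !update_eq; split=> // z /orP[/mono->|->] //.
  by rewrite orbT.
have lnk2 : linked (arr s2 6) (arr s2 7) c (arr s2 5 (nreg s2 2))
    (if x \in C then [::] else nbrs D x) by rewrite a2 x2; apply: lnk.
rewrite cats0; apply: wp_imp (discard_nbrs_spec lnk2 r42 r52) _.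
move=> t3 s3 [-> fr3 a35 f3].
have [fn _ fa] := fr3; have regs3 := frame_const_regs fr3 regs2.
rewrite a2 x2 in a35; rewrite a2 in f3.
have n63 : nreg s3 6 = nreg s 6 by rewrite fn.
have mono z : arr s 2 z != 0%N -> arr s3 2 z != 0%N by rewrite f3; case: ifP.
have static : [/\ arr s3 0 = arr (init [::]) 0, arr s3 1 = arr (init [::]) 1 &
    forall y, arr s3 3 y = count orc (nbrs D y) /\
              arr s3 4 y = count (predC orc) (nbrs D y)].
  by split=> [||y]; rewrite !fa // ?a2 //.
(* A chosen vertex met again has an emptied list, so nothing changes; otherwise [x] joins [C]. *)
case: ifPn f3 => [xC|xC] f3.
  exists C; rewrite /=; split=> //; first by lia.
    split=> //.
    - exists c => y; rewrite (fa 6) // (fa 7) // a2 a35 /update; case: (eqVneq y x) => [->|_] //.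
      by rewrite xC.
    - by move=> y /inC[fy py fny]; split=> // [|z /fny /mono //]; rewrite f3.
    - by move=> y; rewrite f3; apply: flg.
  by rewrite /visited xC orbT; split=> // z; rewrite f3.
(* A chosen neighbour of [x] would have flagged [x]. So flagging the neighbours of [x] spares
   [C]. *)
have xnC y : y \in C -> y \notin nbrs D x.
  move=> yC; apply/negP; rewrite nsym => xy; have [_ _ fny] := inC y yC.
  by have := fny _ xy; rewrite fx.
exists (x :: C); rewrite /total_degree big_cons /=; split=> //.
- by rewrite -/(total_degree D C); lia.
- by rewrite xC.
- split=> //.
  + exists c => y; rewrite (fa 6) // (fa 7) // a2 a35 /update in_cons.
    by case: (eqVneq y x) => [->|_] //=; rewrite lnk.
  + move=> y; rewrite in_cons => /orP[/eqP->|yC].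
      split=> //; first by rewrite f3 (negbTE (nirr x)).
      by move=> y' y'x; rewrite f3 y'x.
    have [fy py fny] := inC y yC; split=> //.
      by rewrite f3 (negbTE (xnC y yC)).
    by move=> z /fny /mono.
  + move=> y; rewrite f3; case: ifP => [yx _|_ /flg].
      by right; exists x; rewrite ?mem_head.
    by case=> [|[z zC yz]]; [left | right; exists z; rewrite ?in_cons ?zC ?orbT].
- rewrite /visited mem_head orbT; split=> // z /orP[/mono->//|zC].
  by rewrite in_cons zC !orbT.
Qed.

Opaque visit.

Lemma selected_set_nreg D C s i c : (i \in [:: 2; 6])%N ->
  selected D C s -> selected D C (set_nreg s i c).
Proof. by case: s => nr me rr co; rewrite !inE => /orP[]/eqP->. Qed.

(** Exchanging the sums, each dart is counted for at most one vertex of the duplicate-free list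
    [C]. *)
Lemma total_degree_le D C : uniq C -> (total_degree D C <= size D)%N.
Proof.
move=> uC; rewrite /total_degree -sum1_size.
under eq_bigr => x _ do rewrite size_map size_filter -sum1_count.
rewrite (exchange_big_dep predT) //=; apply: leq_sum => d _.
by rewrite sum1_count (eq_count (a2 := pred1 d.1)) ?count_uniq_mem ?leq_b1 // => x /=.
Qed.

Lemma size_darts es' : size (darts es') = (2 * size es')%N.
Proof. by elim: es' => //= uv es' ->; rewrite mulnS. Qed.

Lemma visit_edges_spec s (D := darts (rev es)) :
  (forall x y, (x \in nbrs D y) = (y \in nbrs D x)) ->
  (forall x, x \notin nbrs D x) ->
  selected D [::] s ->
  wp visit_edges s (fun t s' => exists C,
    [/\ (t <= 50 * m + 2)%N, selected D C s' &
        forall uv, uv \in es -> visited C s' uv.1 /\ visited C s' uv.2]).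
Proof.
move=> nsym nirr sel; apply: wp_step => /=.
(* 42 is one test, two reads, two visits at 19 and one increment. The potential stays below
   [4 * (2 * m)], whence [50 * m + 2] in the end. *)
pose Inv i t s := nreg s 6 = i /\ exists C,
  [/\ (t <= 42 * i + 4 * total_degree D C)%N, uniq C, selected D C s &
      forall uv, uv \in take i es -> visited C s uv.1 /\ visited C s uv.2].
set q := While _ _; set s0 := set_nreg _ _ _.
have: wp [:: q] s0 (fun t s => exists2 t0, t = t0.+1 & Inv m t0 s).
  apply: wp_for => [|i t s1 ltim [r6 [C [t_le uC sel1 vis]]]
    |t s1 [r6 [C [_ _ [[[r1 _ _] _] _ _ _ _] _]]]].
  - by split=> //; exists [::]; rewrite take0; split=> //; apply: selected_set_nreg.
  - have [[[r1 _ _] _] [a0 _ _] _ _ _] := sel1.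
    rewrite /= r1 r6; split=> //.
    have [uv [uvin takeE e0 e1]] := edge_at ltim.
    apply: wp_step => /=; apply: wp_cat.
    set s2 := set_nreg _ _ _.
    have sel2 : selected D C s2 by apply: selected_set_nreg.
    apply: wp_imp (visit_spec nsym nirr uC sel2) _.
    move=> t3 s3 [C3 [t3_le uC3 sel3 r63 [visx mono3]]].
    have {}visx : visited C3 s3 uv.1.
      by move: visx; rewrite /s2 /= update_eq a0 r6 e0.
    have {}mono3 z : visited C s1 z -> visited C3 s3 z by apply: mono3.
    have {}r63 : nreg s3 6 = i by rewrite r63.
    have [_ [_ a1 _] _ _ _] := sel3.
    apply: wp_step => /=; apply: wp_cat.
    set s4 := set_nreg _ _ _.
    have sel4 : selected D C3 s4 by apply: selected_set_nreg.
    apply: wp_imp (visit_spec nsym nirr uC3 sel4) _.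
    move=> t5 s5 [C5 [t5_le uC5 sel5 r65 [visy mono5]]].
    have {}visy : visited C5 s5 uv.2.
      by move: visy; rewrite /s4 /= update_eq a1 r63 e1.
    have {}mono5 z : visited C3 s3 z -> visited C5 s5 z by apply: mono5.
    have {}r65 : nreg s5 6 = i by rewrite r65.
    apply: wp_step => /=; apply: wp_nil; split; first by rewrite /= update_eq r65.
    exists C5; split=> //; first by lia.
    move=> uv'; rewrite -mem_rev takeE in_cons mem_rev => /orP[/eqP->|/vis[v1 v2]].
      by split; [apply: mono5|].
    by split; apply/mono5/mono3.
  - by rewrite /= r1 r6 ltnn.
move=> w; apply: wp_imp w _ => t s' [t0 -> [_ [C [t_le uC sel' vis]]]].
exists C; split=> //; last by move=> uv uvin; apply: vis; rewrite take_size.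
by have := total_degree_le D uC; rewrite size_darts size_rev; lia.
Qed.

Lemma nbrs_visited (D := darts (rev es)) C s x :
  (forall uv, uv \in es -> visited C s uv.1 /\ visited C s uv.2) ->
  nbrs D x != [::] -> visited C s x.
Proof.
move=> vis; rewrite -size_eq0 size_map size_filter -lt0n -has_count.
case/hasP => d /flatten_mapP[uv]; rewrite mem_rev => /vis[v1 v2].
by rewrite !inE => /orP[]/eqP-> /eqP<-.
Qed.

Lemma prog_spec r (D := darts (rev es)) : (0 < m)%N ->
  (forall x y, (x \in nbrs D y) = (y \in nbrs D x)) ->
  (forall x, x \notin nbrs D x) ->
  wp prog (init r) (fun t s =>
    [/\ (t <= 100 * m)%N,
        forall x y, arr s 2 x = 0%N -> arr s 2 y = 0%N -> x \notin nbrs D y,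
        forall x, arr s 2 x = 0%N -> passes D x &
        forall x, arr s 2 x != 0%N ->
          ~~ passes D x \/ exists2 y, arr s 2 y = 0%N & x \in nbrs D y]).
Proof.
move=> m_gt0 nsym nirr; apply: wp_cat.
apply: wp_imp (prelude_spec r m_gt0) _ => t1 s1 [t1_le regs1 r6 r7 a1].
apply: wp_cat; apply: wp_imp (record_edges_spec regs1 r6 r7 a1) _.
move=> t2 s2 [-> [regs2 [a20 a21 a22] cnt2 lnk2]].
have sel2 : selected D [::] s2.
  by split=> //; [exists (nreg s2 7) | move=> x; rewrite a22].
apply: wp_imp (visit_edges_spec nsym nirr sel2) _ => t3 s3 [C [t3_le sel3 vis3]].
have [_ _ _ inC flg] := sel3.
(* An unflagged vertex is isolated or was chosen. An isolated one has score 0 and passes the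
   test. *)
have visC x : arr s3 2 x = 0%N -> nbrs D x = [::] \/ x \in C.
  move=> fx; case: (eqVneq (nbrs D x) [::]) => [->|]; first by left.
  by move/(nbrs_visited vis3); rewrite /visited fx; right.
(* The phases add up to [(3m + 9) + (26m + 1) + (50m + 2)], at most [100m] because [m >= 1]. *)
split; first by lia.
- move=> x y fx fy; apply/negP => xy; have [Ey|yC] := visC y fy.
    by rewrite Ey in xy.
  by have [_ _ /(_ x xy)] := inC y yC; rewrite fx.
- move=> x /visC[Ex|/inC[]//].
  by rewrite /passes Ex /= !(subrr, addr0, mul0r) lexx.
- move=> x /flg[|[y yC xy]]; [by left | right; exists y => //].
  by have [] := inC y yC.
Qed.
End Correct.

(** * From adjacency lists to the graph *)

Section Graph.
Variables (n : nat) (e : rel 'I_n) (es : seq ('I_n * 'I_n)).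
Hypotheses (e_simple : simple_graph e) (es_listing : edge_listing e es).

Lemma size_listing : size es = num_edges e.
Proof. by have /perm_size := es_listing; rewrite size_map -cardE. Qed.

Lemma eq_pair (a b v u : 'I_n) :
  ([set a; b] == [set v; u]) =
  ((a == v) && (b == u)) || ((a == u) && (b == v)).
Proof.
apply/eqP/idP => [E|/orP[]/andP[/eqP-> /eqP->] //]; last by rewrite finset.setUC.
have: a \in [set v; u] by rewrite -E set21.
have: b \in [set v; u] by rewrite -E set22.
have: v \in [set a; b] by rewrite E set21.
have: u \in [set a; b] by rewrite E set22.
rewrite !inE ![u == _]eq_sym ![v == _]eq_sym.
by case: (a == v); case: (a == u); case: (b == v); case: (b == u).
Qed.

Lemma mem_edge_set v u : ([set v; u] \in edge_set e) = e v u.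
Proof.
have [esym _] := e_simple; apply/imsetP/idP => [[[a b] /= eab /eqP]|evu].
  by rewrite inE /= in eab; rewrite eq_pair => /orP[]/andP[/eqP-> /eqP->]; rewrite // esym.
by exists (v, u); rewrite ?inE.
Qed.

(** Double counting: [F S] is the contribution of the edge [S] to the neighbours of [v]. Its sum
    over [edge_set e] is the cardinality; as [es] lists each edge once, the sum can also be taken
    along [es], dart by dart. A loop would give two darts at the same vertex, hence [nloop]. *)
Lemma count_nbrs (P : pred nat) (v : 'I_n) :
  count P (nbrs (darts (rev es)) v) = #|[set u | e v u & P u]|.
Proof.
have [_ eirr] := e_simple.
pose F (S : {set 'I_n}) := (\sum_(u : 'I_n | P u) (S == [set v; u]))%N.
have -> : #|[set u | e v u & P u]| = (\sum_(S in edge_set e) F S)%N.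
  rewrite exchange_big /= -sum1dep_card big_mkcond [RHS]big_mkcond /=.
  apply: eq_bigr => u _; rewrite andbC; case: (P u) => //=.
  rewrite -big_mkcondr /= -mem_edge_set.
  case: ifPn => [uvE|uvE].
    rewrite (big_pred1 [set v; u]) // => S /=.
    by case: eqVneq => [->|_]; rewrite ?uvE ?andbF.
  rewrite big_pred0 // => S /=.
  by case: eqVneq => [->|_]; rewrite ?(negbTE uvE) ?andbF.
transitivity (\sum_(uv <- es) F [set uv.1; uv.2])%N; last first.
  rewrite -(big_map (fun uv => [set uv.1; uv.2]) predT F).
  by rewrite (perm_big _ es_listing) big_enum.
have nloop uv : uv \in es -> uv.1 != uv.2.
  move=> uvin; have: [set uv.1; uv.2] \in edge_set e.
    by rewrite -mem_enum -(perm_mem es_listing); apply: map_f.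
  by rewrite mem_edge_set; apply: contraTneq => ->; rewrite eirr.
have rev_es : perm_eq (rev es) es by rewrite perm_rev.
rewrite -(perm_big _ rev_es) /=.
have {nloop}: forall uv, uv \in rev es -> uv.1 != uv.2.
  by move=> uv; rewrite mem_rev; apply: nloop.
elim: (rev es) => [|[a b] es' IHes] nloop; first by rewrite big_nil.
rewrite big_cons -IHes => [|uv uvin]; last by apply: nloop; rewrite in_cons uvin orbT.
have /= neq_ab := nloop (a, b) (mem_head _ _).
have sum_pick (c : 'I_n) : (\sum_(u : 'I_n | P u) (c == u) = P c)%N.
  rewrite big_mkcond (bigD1 c) //= eqxx big1 ?addn0; first by case: (P c).
  by move=> u; rewrite eq_sym => /negbTE->; case: (P u).
rewrite /F; under eq_bigr => u _ do rewrite eq_pair.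
rewrite /nbrs /= !(inj_eq val_inj); case: (eqVneq a v) => [<-|neq_av].
  rewrite eq_sym (negbTE neq_ab) /= -sum_pick; congr (_ + _)%N.
  by apply: eq_bigr => u _; rewrite andbF orbF.
case: (eqVneq b v) => [_|_] /=.
  by rewrite -sum_pick; congr (_ + _)%N; apply: eq_bigr => u _; rewrite andbT.
by rewrite big1 // => u _; rewrite andbF.
Qed.

Lemma nbrsP (x y : nat) :
  reflect (exists u v : 'I_n, [/\ x = u, y = v & e v u])
          (x \in nbrs (darts (rev es)) y).
Proof.
have mem_count (v : 'I_n) : (x \in nbrs (darts (rev es)) v) =
    (0 < #|[set u | e v u & val u == x]|)%N.
  by rewrite -has_pred1 has_count count_nbrs.
apply: (iffP idP) => [xy|[u [v [-> -> evu]]]]; last first.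
  by rewrite -has_pred1 has_count count_nbrs; apply/card_gt0P; exists u; rewrite inE evu /=.
have [v yv] : exists v : 'I_n, y = v.
  have /mapP[d] := xy; rewrite mem_filter => /andP[/eqP<- /flatten_mapP[uv _ din]] _.
  by move: din; rewrite !inE => /orP[]/eqP->; [exists uv.2 | exists uv.1].
move: xy; rewrite yv mem_count => /card_gt0P[u].
by rewrite inE => /andP[evu /eqP xu]; exists u, v.
Qed.

Definition passes_test (R : realFieldType) (eps : R) (a : {ffun 'I_n -> bool}) v : bool :=
  let yes := #|[set u | e v u & a u]|%:R : R in
  let no := #|[set u | e v u & ~~ a u]|%:R in
  let w := yes - no + (yes + no) * eps + (yes + no) * eps in
  (w <= 0) || (w * w <= (yes + no) * log_weight R es).

Lemma prog_run (R : realFieldType) (eps : R) (a : {ffun 'I_n -> bool}) r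
    (c := run prog es eps a r (100 * num_edges e)) :
  (0 < num_edges e)%N ->
  [/\ halted c, independent e (output n c),
      forall v, v \in output n c -> passes_test eps a v &
      forall v, v \notin output n c ->
        ~~ passes_test eps a v \/ exists2 u, u \in output n c & e u v].
Proof.
move=> m_gt0; have [esym eirr] := e_simple.
have nsym (x y : nat) : (x \in nbrs (darts (rev es)) y) = (y \in nbrs (darts (rev es)) x).
  by apply/nbrsP/nbrsP => -[u [v [-> -> evu]]]; exists v, u; rewrite esym.
have nirr (x : nat) : x \notin nbrs (darts (rev es)) x.
  by apply/nbrsP => -[u [v [-> /val_inj->]]]; rewrite eirr.
have passesE v : passes (oracle_table a) es eps (darts (rev es)) (val v) =
    passes_test eps a v.
  have tableE (u : 'I_n) : oracle_table a u = a u by rewrite /oracle_table valK.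
  rewrite /passes !count_nbrs /passes_test.
  have -> : [set u | e v u & oracle_table a u] = [set u | e v u & a u].
    by apply/setP => u; rewrite !inE tableE.
  have -> // : [set u | e v u & predC (oracle_table a) (val u)] = [set u | e v u & ~~ a u].
  by apply/setP => u; rewrite !inE /= tableE.
have m_gt0' : (0 < size es)%N by rewrite size_listing.
have [t [s [runE [t_le indep pass flg]]]] :=
  prog_spec (oracle_table a) eps r m_gt0' nsym nirr.
have cE : c = ([::], s).
  have := runE [::]; rewrite cats0 => run_t.
  (* A halted configuration is a fixed point of [step], so the run may be prolonged to exactly
     [100 * num_edges e] steps. *)
  rewrite /c /run -(subnK (_ : t <= 100 * num_edges e)%N) ?iterD ?run_t.
    by elim: (_ - _)%N => //= k ->.
  by rewrite -size_listing.
rewrite cE; split=> //.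
- apply/forall_inP => u; rewrite inE => /eqP fu; apply/forall_inP => v.
  rewrite inE => /eqP fv; apply: contra (indep v u fv fu) => euv.
  by apply/nbrsP; exists v, u.
- by move=> v; rewrite inE => /eqP fv; rewrite -passesE pass.
move=> v; rewrite inE => /flg[|[y fy /nbrsP[v' [u [/val_inj<- yu evu]]]]].
  by rewrite passesE; left.
by right; exists u; rewrite // inE -yu fy.
Qed.
End Graph.

(** * Concentration of the oracle answers *)

Section Concentration.
Variable R : realType.
Implicit Types (y lambda : R).

Lemma expR_le_quadratic y : y <= 1 -> expR y <= 1 + y + 2 * y ^+ 2.
Proof.
(* [expR (- (y / 2)) >= 1 - y / 2 > 0], and [(1 + y + 2 y^2) (1 - y / 2)^2 >= 1]. *)
move=> y_le1; have pos : 0 < (1 - y / 2) ^+ 2 by apply: exprn_gt0; lra.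
rewrite -(ler_pM2r pos); apply: (@le_trans _ _ (expR y * expR (- (y / 2)) ^+ 2)).
  rewrite ler_pM2l ?expR_gt0 //; have := expR_ge1Dx (- (y / 2)) => le_e.
  by apply: lerXn2r; rewrite ?nnegrE ?expR_ge0; lra.
have -> : expR y * expR (- (y / 2)) ^+ 2 = 1.
  by rewrite -expRM_natl -expRD -[RHS]expR0; congr expR; field.
have : 0 <= y ^+ 2 * ((1 - y) * (5 / 2 - y) / 2).
  by rewrite mulr_ge0 ?sqr_ge0 // divr_ge0 // mulr_ge0; lra.
by lra.
Qed.

Variables (n : nat) (Istar : {set 'I_n}) (eps : R).
Hypotheses (eps_gt0 : 0 < eps) (eps_le : eps <= 1 / 2).
Implicit Type a : {ffun 'I_n -> bool}.

Definition answer_prob (v : 'I_n) (b : bool) : R :=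
  if b == (v \in Istar) then 1 / 2 + eps else 1 / 2 - eps.

Definition bool_sign (b : bool) : R := if b then 1 else -1.

Definition mean_sign (v : 'I_n) : R := if v \in Istar then 2 * eps else - (2 * eps).

Definition deviation (N : {set 'I_n}) a : R :=
  \sum_(u in N) (bool_sign (a u) - mean_sign u).

Lemma oracle_lawE a : oracle_law Istar eps a = \prod_v answer_prob v (a v).
Proof. by []. Qed.

Lemma answer_prob_ge0 v b : 0 <= answer_prob v b.
Proof. by move: eps_gt0 eps_le; rewrite /answer_prob; case: ifP => _; lra. Qed.

Lemma oracle_law_ge0 a : 0 <= oracle_law Istar eps a.
Proof. by rewrite oracle_lawE; apply: prodr_ge0 => v _; apply: answer_prob_ge0. Qed.

Lemma sum_answer_prob v : \sum_b answer_prob v b = 1.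
Proof. by rewrite big_bool /answer_prob; case: (v \in Istar) => /=; field. Qed.

(** Independence: the expectation of a product over the vertices is the product of the
    expectations. *)
Lemma oracle_law_prod (F : 'I_n -> bool -> R) :
  \sum_a oracle_law Istar eps a * \prod_v F v (a v) =
  \prod_v \sum_b answer_prob v b * F v b.
Proof.
rewrite bigA_distr_bigA /=; apply: eq_bigr => a _.
by rewrite oracle_lawE -big_split.
Qed.

Lemma sum_oracle_law : \sum_a oracle_law Istar eps a = 1.
Proof.
transitivity (\sum_a oracle_law Istar eps a * \prod_(v < n) 1).
  by apply: eq_bigr => a _; rewrite big1_eq mulr1.
rewrite (oracle_law_prod (fun _ _ => 1)) big1 // => v _.
by under eq_bigr => b _ do rewrite mulr1; rewrite sum_answer_prob.
Qed.

(** The quadratic bound on [expR] applies because the centred sign is at most 2 in absolute value.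
    The linear term averages to 0 and the square to the variance [1 - 4 * eps ^+ 2], at most 1. *)
Lemma sign_mgf lambda v : `|lambda| <= 1 / 2 ->
  \sum_b answer_prob v b * expR (lambda * (bool_sign b - mean_sign v)) <=
  expR (2 * lambda ^+ 2).
Proof.
rewrite ler_norml => /andP[l_ge l_le].
apply: (@le_trans _ _ (1 + 2 * lambda ^+ 2)); last exact: expR_ge1Dx.
pose z b := lambda * (bool_sign b - mean_sign v).
have z_le1 b : z b <= 1.
  move: eps_gt0 eps_le => e0 e1.
  by rewrite /z /bool_sign /mean_sign; case: b; case: ifP => _; nra.
have quad b : answer_prob v b * expR (z b) <= answer_prob v b * (1 + z b + 2 * z b ^+ 2).
  by rewrite ler_wpM2l ?answer_prob_ge0 ?expR_le_quadratic.
apply: le_trans (ler_sum _ (fun b _ => quad b)) _.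
rewrite big_bool /answer_prob /z /bool_sign /mean_sign.
have : 0 <= lambda ^+ 2 * eps ^+ 2 by rewrite mulr_ge0 ?sqr_ge0.
by case: (v \in Istar) => /=; lra.
Qed.

Lemma deviation_mgf (N : {set 'I_n}) lambda : `|lambda| <= 1 / 2 ->
  \sum_a oracle_law Istar eps a * expR (lambda * deviation N a) <=
  expR (2 * lambda ^+ 2 * #|N|%:R).
Proof.
move=> l_le.
pose F v b := if v \in N then expR (lambda * (bool_sign b - mean_sign v)) else 1.
have -> : \sum_a oracle_law Istar eps a * expR (lambda * deviation N a) =
    \sum_a oracle_law Istar eps a * \prod_v F v (a v).
  by apply: eq_bigr => a _; rewrite mulr_sumr expR_sum [in LHS]big_mkcond.
have -> : expR (2 * lambda ^+ 2 * #|N|%:R) =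
    \prod_v (if v \in N then expR (2 * lambda ^+ 2) else 1).
  by rewrite -big_mkcond prodr_const -expRM_natl mulrC.
rewrite oracle_law_prod; apply: ler_prod => v _; rewrite /F; apply/andP; split.
  rewrite sumr_ge0 // => b _; rewrite mulr_ge0 ?answer_prob_ge0 //.
  by case: ifP => _; rewrite ?expR_ge0.
case: ifP => _; first exact: sign_mgf.
by under eq_bigr => b _ do rewrite mulr1; rewrite sum_answer_prob.
Qed.

Lemma norm_deviation (N : {set 'I_n}) a : `|deviation N a| <= 2 * #|N|%:R.
Proof.
rewrite mulrC mulr_natl -sumr_const; apply: le_trans (ler_norm_sum _ _ _) _.
apply: ler_sum => u _; rewrite /bool_sign /mean_sign ler_norml.
move: eps_gt0 eps_le => e0 e1.
by case: (a u); case: (u \in Istar); apply/andP; split; lra.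
Qed.

(** Chernoff bound for either tail, [neg] choosing the side. With d the size of [N] and
    [t ^+ 2 = d * M], the exponent [2 * l ^+ 2 * d - l * t] equals [- (M / 8)] for the [l] below. *)
Lemma deviation_tail (N : {set 'I_n}) (neg : bool) (M : R) : 0 <= M ->
  \sum_(a | Num.sqrt (#|N|%:R * M) < (-1) ^+ neg * deviation N a)
    oracle_law Istar eps a <= expR (- (M / 8)).
Proof.
move=> M_ge0; set t := Num.sqrt _.
have t_ge0 : 0 <= t by apply: sqrtr_ge0.
(* If [t >= 2 d], the event is empty, as the deviation never exceeds [2 d]. Otherwise the optimal
   [l] is at most 1/2. *)
have [t_ge|t_lt] := leP (2 * #|N|%:R) t.
  rewrite big_pred0 ?expR_ge0 // => a; apply/negbTE; rewrite -leNgt.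
  apply: le_trans t_ge; apply: le_trans (norm_deviation N a).
  by apply: le_trans (ler_norm _) _; rewrite normrMsign.
have d_gt0 : 0 < #|N|%:R :> R by lra.
have tE : t ^+ 2 = #|N|%:R * M by rewrite sqr_sqrtr // mulr_ge0 // ltW.
pose l := t / (4 * #|N|%:R).
have l_ge0 : 0 <= l by rewrite divr_ge0 // mulr_ge0 // ltW.
have l_le : l <= 1 / 2 by rewrite ler_pdivrMr; lra.
have nl_le : `|(-1) ^+ neg * l| <= 1 / 2.
  by rewrite normrMsign ger0_norm.
(* Markov: on the event the exponential factor is at least 1. *)
apply: (@le_trans _ _ (\sum_a oracle_law Istar eps a *
    expR (((-1) ^+ neg * l) * deviation N a - l * t))).
  rewrite [leRHS](bigID (fun a => t < (-1) ^+ neg * deviation N a)) /=.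
  rewrite -[leLHS]addr0 lerD //; last first.
    by apply: sumr_ge0 => a _; rewrite mulr_ge0 ?oracle_law_ge0 ?expR_ge0.
  apply: ler_sum => a ta; rewrite ler_peMr ?oracle_law_ge0 // -[leLHS]expR0 ler_expR.
  by rewrite subr_ge0 -mulrA mulrCA ler_wpM2l // ltW.
have -> : \sum_a oracle_law Istar eps a *
    expR (((-1) ^+ neg * l) * deviation N a - l * t) =
    (\sum_a oracle_law Istar eps a * expR (((-1) ^+ neg * l) * deviation N a)) *
    expR (- (l * t)).
  by rewrite mulr_suml; apply: eq_bigr => a _; rewrite expRD mulrA.
apply: le_trans (ler_wpM2r (expR_ge0 _) (deviation_mgf N nl_le)) _.
rewrite -expRD ler_expR exprMn -exprM mulnC exprM sqrrN !expr1n mul1r.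
have -> : l * t = #|N|%:R * M / (4 * #|N|%:R) by rewrite /l mulrAC -expr2 tE.
have -> : l ^+ 2 = #|N|%:R * M / (4 * #|N|%:R) ^+ 2 by rewrite /l expr_div_n tE.
by rewrite le_eqVlt; apply/orP; left; apply/eqP; field; rewrite gt_eqF.
Qed.

End Concentration.

(** * The selected vertices *)

Section Selection.
Variables (R : realType) (n : nat) (e : rel 'I_n) (es : seq ('I_n * 'I_n)).
Variables (Istar : {set 'I_n}) (eps : R).
Hypotheses (eps_gt0 : 0 < eps) (eps_le : eps <= 1 / 2).
Hypotheses (e_simple : simple_graph e) (Istar_indep : independent e Istar).
Implicit Type a : {ffun 'I_n -> bool}.

Local Notation L := (log_weight R es).

Definition nbhd v := [set u | e v u].

(** The shift makes the mean contribution of a neighbour 0 outside [Istar] and [4 * eps] inside. *)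
Definition score a v : R := \sum_(u in nbhd v) (bool_sign R (a u) + 2 * eps).

Lemma passes_testE a v :
  passes_test e es eps a v =
  (score a v <= 0) || (score a v * score a v <= #|nbhd v|%:R * L).
Proof.
have cardE (P : pred 'I_n) :
    #|[set u | e v u & P u]|%:R = \sum_(u in nbhd v) (P u)%:R :> R.
  rewrite -natr_sum; congr (_%:R); rewrite -sum1dep_card big_mkcond [RHS]big_mkcond.
  by apply: eq_bigr => u _; rewrite inE; case: (e v u); case: (P u).
have degE : #|nbhd v|%:R = \sum_(u in nbhd v) (1 : R) by rewrite sumr_const.
have yesno : #|[set u | e v u & a u]|%:R + #|[set u | e v u & ~~ a u]|%:R
    = #|nbhd v|%:R :> R.
  rewrite !cardE degE -big_split; apply: eq_bigr => u _ /=.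
  by case: (a u); rewrite ?addr0 ?add0r.
rewrite /passes_test yesno.
have -> // : #|[set u | e v u & a u]|%:R - #|[set u | e v u & ~~ a u]|%:R +
    #|nbhd v|%:R * eps + #|nbhd v|%:R * eps = score a v.
rewrite !cardE degE -sumrB mulr_suml -!big_split; apply: eq_bigr => u _ /=.
by rewrite /bool_sign; case: (a u) => /=; ring.
Qed.

Lemma score_deviation a v :
  score a v = deviation Istar eps (nbhd v) a + 4 * eps * #|nbhd v :&: Istar|%:R.
Proof.
rewrite -sum1_card natr_sum mulr_sumr /deviation.
under [X in _ = _ + X]eq_bigl => u do rewrite finset.in_setI.
rewrite [X in _ = _ + X]big_mkcondr -big_split; apply: eq_bigr => u _ /=.
by rewrite /mean_sign; case: (u \in Istar); ring.
Qed.

(** Only one tail is harmful: a score too high inside [Istar], too low outside. So each vertex pays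
    for a single tail bound. *)
Definition atypical v a : bool :=
  Num.sqrt (#|nbhd v|%:R * L) <
  (-1) ^+ (v \notin Istar) * deviation Istar eps (nbhd v) a.

Lemma atypical_prob v :
  \sum_(a | atypical v a) oracle_law Istar eps a <= expR (- (L / 8)).
Proof. by apply: deviation_tail => //; apply: log_weight_ge0. Qed.

(** A vertex of [Istar] has no neighbour in [Istar], so its score is the deviation itself. *)
Lemma typical_in a v : v \in Istar -> ~~ atypical v a -> passes_test e es eps a v.
Proof.
move=> vI; rewrite /atypical vI /= expr0 mul1r -leNgt passes_testE.
have no_nbr : nbhd v :&: Istar = finset.set0.
  apply/setP => u; rewrite !inE; apply/negbTE/negP => /andP[evu uI].
  by have /forall_inP/(_ v vI)/forall_inP/(_ u uI) := Istar_indep; rewrite evu.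
have := score_deviation a v; rewrite no_nbr cards0 mulr0 addr0 => <- le_sqrt.
have [//|w_gt0] := leP (score a v) 0; rewrite /= -expr2.
have pos : 0 <= #|nbhd v|%:R * L by rewrite mulr_ge0 ?log_weight_ge0.
by rewrite -(sqr_sqrtr pos) ler_pXn2r ?nnegrE ?sqrtr_ge0 // ltW.
Qed.

(** With s the square root and k the number of neighbours in [Istar], the score is at least
    [4 eps k - s] and, having passed, at most s. *)
Lemma typical_out a v : v \notin Istar -> ~~ atypical v a ->
  passes_test e es eps a v ->
  2 * eps * #|nbhd v :&: Istar|%:R <= Num.sqrt (#|nbhd v|%:R * L).
Proof.
move=> vI; rewrite /atypical vI /= expr1 mulN1r -leNgt passes_testE => le_sqrt.
have le_score : (score a v <= 0) || (score a v * score a v <= #|nbhd v|%:R * L) ->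
    score a v <= Num.sqrt (#|nbhd v|%:R * L).
  case: (leP (score a v) 0) => [w_le0 _|w_gt0 /= le2].
    exact: le_trans w_le0 (sqrtr_ge0 _).
  by rewrite -[leLHS]gtr0_norm // -sqrtr_sqr ler_wsqrtr.
by move/le_score; rewrite score_deviation; lra.
Qed.

(** Double counting of the pairs [u] in [J], [v] in [Istar] that are equal or adjacent. Each [v] is
    hit; a [u] in [Istar] hits only itself by independence, and any other [u] hits at most [K]
    vertices. *)
Lemma card_dominated (J : {set 'I_n}) (K : R) : 1 <= K ->
  (forall v, v \in J -> v \notin Istar -> #|nbhd v :&: Istar|%:R <= K) ->
  (forall v, v \in Istar -> v \notin J -> exists2 u, u \in J & e u v) ->
  #|Istar|%:R <= K * #|J|%:R.
Proof.
move=> K_ge1 sparse dom.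
pose hit u v := (u == v) || e u v.
apply: (@le_trans _ _ (\sum_(v in Istar) \sum_(u in J) (hit u v)%:R)).
  rewrite -sum1_card natr_sum; apply: ler_sum => v vI.
  have [u uJ huv] : exists2 u, u \in J & hit u v.
    have [vJ|vJ] := boolP (v \in J); first by exists v; rewrite /hit ?eqxx.
    by have [u uJ euv] := dom v vI vJ; exists u; rewrite /hit ?euv ?orbT.
  by rewrite (bigD1 u) //= huv lerDl sumr_ge0.
rewrite exchange_big mulrC mulr_natl -sumr_const; apply: ler_sum => u uJ.
have [uI|uI] := boolP (u \in Istar).
  rewrite (bigD1 u) //= /hit eqxx big1 ?addr0 // => v /andP[vI neq_vu].
  have /forall_inP/(_ u uI)/forall_inP/(_ v vI)/negbTE-> := Istar_indep.
  by rewrite eq_sym (negbTE neq_vu).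
apply: le_trans (sparse u uJ uI).
rewrite -sum1_card natr_sum [leRHS](eq_bigl (fun v => (v \in Istar) && e u v)); last first.
  by move=> v; rewrite !inE andbC.
rewrite [leRHS]big_mkcondr; apply: ler_sum => v vI; rewrite /hit.
by case: eqVneq => [uv|_]; [rewrite uv vI in uI | case: (e u v)].
Qed.

End Selection.

(** * Edges and non-isolated vertices *)

Section Graph_size.
Variables (n : nat) (e : rel 'I_n).

Lemma num_edges_le : (num_edges e <= n ^ 2)%N.
Proof.
apply: leq_trans (leq_imset_card _ _) _.
by apply: leq_trans (max_card _) _; rewrite card_prod card_ord.
Qed.

Lemma card_nonisolated : (#|[set v | [exists u, e v u]]| <= 2 * num_edges e)%N.
Proof.
apply: leq_trans (_ : #|finset.cover (edge_set e)| <= _)%N.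
  apply/subset_leq_card/fintype.subsetP => v; rewrite inE => /existsP[u evu].
  apply/finset.bigcupP; exists [set v; u]; last by rewrite set21.
  by apply/imsetP; exists (v, u); rewrite ?inE.
apply: leq_trans (leq_card_cover _).1 _.
rewrite mulnC -sum_nat_const; apply: leq_sum => S /imsetP[uv _ ->].
by rewrite cards2; case: (_ == _).
Qed.

End Graph_size.

(** * Comparison of [L] with [ln n] *)

Section Logarithm.
Variable R : realType.

Lemma ln2_le1 : ln 2 <= 1 :> R.
Proof. by have := @le_ln1Dx R 1; rewrite (_ : 1 + 1 = 2) //; apply; lra. Qed.

Lemma ln2_ge : 1 / 2 <= ln 2 :> R.
Proof.
rewrite -[leLHS]expRK ler_ln ?posrE ?expR_gt0 //.
(* At 1/2 the quadratic bound equals exactly 2. *)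
by have := @expR_le_quadratic R (1 / 2); lra.
Qed.

(** The factor 16 makes [expR (- (L / 8))] at most [n ^ -2]; 576 is [24 ^ 2], which leads to the 12
    of the guarantee. The lower bound comes from [n < 4m < 2 ^ (j + 3)], the upper one from
    [2 ^ j <= m <= n ^ 2]. *)
Lemma log_weight_bounds n (es : seq ('I_n * 'I_n)) :
  (0 < size es <= n ^ 2)%N -> (n < 4 * size es)%N -> (1 < n)%N ->
  16 * ln n%:R <= log_weight R es <= 576 * ln n%:R.
Proof.
move=> /andP[m_gt0 m_le] n_lt n_gt1; rewrite /log_weight.
set j := trunc_log 2 _.
have lnX k : ln (2 ^ k)%:R = k%:R * ln 2 :> R by rewrite natrX lnXn // mulr_natl.
have nR_gt0 : 0 < n%:R :> R by rewrite ltr0n ltnW.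
have lo : ln n%:R <= (3 * j.+1)%:R * ln 2 :> R.
  rewrite -lnX ler_ln ?posrE // ?ltr0n ?expn_gt0 // ler_nat.
  have := trunc_log_ltn (size es) (isT : 1 < 2)%N; rewrite -/j => lt_m.
  apply: (@leq_trans (2 ^ j.+3)); first by rewrite -[j.+3]/(2 + j.+1)%N expnD; lia.
  by rewrite leq_exp2l //; lia.
have hi : j%:R * ln 2 <= 2 * ln n%:R :> R.
  have -> : 2 * ln n%:R = ln (n ^ 2)%:R :> R by rewrite natrX lnXn // mulr_natl.
  rewrite -lnX ler_ln ?posrE ?ltr0n ?expn_gt0 ?(ltnW n_gt1) //= ler_nat.
  by apply: leq_trans (trunc_logP _ m_gt0) m_le.
have ln2_le : ln 2 <= ln n%:R :> R by rewrite ler_ln ?posrE // ler_nat.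
have h1 := ln2_le1; have h2 := ln2_ge.
have j_ge0 : 0 <= j%:R :> R by [].
rewrite natrM -addn1 natrD in lo *.
by apply/andP; split; nra.
Qed.

End Logarithm.

(** * The approximation guarantee *)

(** Union bound over the [n] vertices. For good answers [E] holds whatever the coins, whose weights
    sum to 1. *)
Lemma Prob_ge (R : realType) n (Istar : {set 'I_n}) (eps : R) T
    (E : {ffun 'I_n -> bool} -> T.-tuple bool -> bool)
    (bad : 'I_n -> {ffun 'I_n -> bool} -> bool) (delta : R) :
  0 < eps -> eps <= 1 / 2 ->
  (forall a r, (forall v, ~~ bad v a) -> E a r) ->
  (forall v, \sum_(a | bad v a) oracle_law Istar eps a <= delta) ->
  1 - n%:R * delta <= Prob Istar eps E.
Proof.
move=> eps_gt0 eps_le goodE bad_le; have law_ge0 := oracle_law_ge0 Istar eps_gt0 eps_le.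
have coins : \sum_(r : T.-tuple bool) (1 / 2) ^+ T = 1 :> R.
  by rewrite sumr_const card_tuple card_bool -[LHS]mulr_natl natrX -exprMn mulrC divfK ?expr1n.
pose good a := [forall v, ~~ bad v a].
have bad_sum : \sum_(a | ~~ good a) oracle_law Istar eps a <= n%:R * delta.
  apply: (@le_trans _ _ (\sum_(v < n) \sum_(a | bad v a) oracle_law Istar eps a)).
    rewrite (exchange_big_dep predT) //= [leRHS](bigID good) /=.
    rewrite -[leLHS]add0r lerD ?sumr_ge0 // => [a _|]; first by rewrite sumr_ge0.
    apply: ler_sum => a; rewrite negb_forall => /existsP[v]; rewrite negbK => bad_v.
    by rewrite (bigD1 v) //= lerDl sumr_ge0.
  apply: le_trans (ler_sum _ (fun v _ => bad_le v)) _.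
  by rewrite sumr_const card_ord mulr_natl.
have := sum_oracle_law Istar eps; rewrite (bigID good) /= => total.
apply: (@le_trans _ _ (\sum_(a | good a) oracle_law Istar eps a)); first by lra.
rewrite /Prob [leRHS](bigID good) /= -[leLHS]addr0 lerD //.
  apply: ler_sum => a /forallP good_a.
  rewrite (eq_bigl xpredT) => [|r]; last by rewrite goodE.
  by rewrite -mulr_sumr coins mulr1.
apply: sumr_ge0 => a _; apply: sumr_ge0 => r _.
by rewrite mulr_ge0 // exprn_ge0.
Qed.

Theorem theorem3p1 (R : realType) :
  exists (p : program) (C k : nat), (0 < k)%N /\
  forall (n : nat) (e : rel 'I_n) (es : seq ('I_n * 'I_n))
         (Istar : {set 'I_n}) (eps : R),
    simple_graph e ->
    edge_listing e es ->
    (0 < num_edges e)%N ->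
    maximum_independent e Istar ->
    0 < eps <= 1 / 2 ->
    let T := (C * num_edges e)%N in
    (forall (a : {ffun 'I_n -> bool}) (r : T.-tuple bool),
        halted (run p es eps a r T) /\
        independent e (output n (run p es eps a r T))) /\
    1 - 1 / n%:R ^+ k <=
      Prob Istar eps (fun (a : {ffun 'I_n -> bool}) (r : T.-tuple bool) =>
        eps / 12 * ((max_degree e)%:R * ln n%:R) `^ (- (1 / 2)) * #|Istar|%:R
          <= #|output n (run p es eps a r T)|%:R :> R).
Proof.
have half (j c k N : nat) :
    (j + c = N -> c <= 2 * k -> 4 * k <= N -> N <= 2 * j)%N by lia.
(* The failure probability is at most [n * n ^ -2], hence the exponent 1. *)
exists prog, 100%N, 1%N; split=> // n e es Istar eps e_simple es_listing m_gt0.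
move=> [Istar_indep _] /andP[eps_gt0 eps_le] T.
have runP a r := prog_run e_simple es_listing eps a r m_gt0.
split=> [a r|]; first by have [] := runP a r.
have [v0 [u0 ev0]] : exists v u, e v u.
  have /card_gt0P[S /imsetP[[v u] evu _]] := m_gt0.
  by exists v, u; rewrite inE in evu.
have n_gt1 : (1 < n)%N.
  rewrite -[n]card_ord; apply/card_gt1P; exists v0, u0; split=> //.
  by apply: contraTneq ev0 => ->; have [_ ->] := e_simple.
have nR_gt0 : 0 < n%:R :> R by rewrite ltr0n ltnW.
have deg_le v : (#|nbhd e v| <= max_degree e)%N.
  exact: (leq_bigmax (F := degree e) v).
have Delta_ge1 : 1 <= (max_degree e)%:R :> R.
  rewrite ler1n; apply: leq_trans (deg_le v0).
  by apply/card_gt0P; exists u0; rewrite inE.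
have ln_ge : 1 / 2 <= ln n%:R :> R.
  by apply: le_trans (ln2_ge R) _; rewrite ler_ln ?posrE // ler_nat.
set x := _ * ln _.
have x_ge : (1 / 2) ^+ 2 <= x by rewrite /x; nra.
have x_gt0 : 0 < x by apply: lt_le_trans x_ge; rewrite exprn_gt0.
have sqrt_ge : 1 / 2 <= Num.sqrt x.
  by rewrite -[leLHS]ger0_norm // -sqrtr_sqr ler_wsqrtr.
(* [K] is the inverse of the approximation factor. The case of many isolated vertices loses a factor
   2, so [2 <= K] is wanted. *)
pose K := 12 * Num.sqrt x / eps.
have K_ge : 2 <= K by rewrite ler_pdivlMr //; lra.
have factorE : eps / 12 * x `^ (- (1 / 2)) = K^-1.
  rewrite powRN div1r powR12_sqrt ?ltW // /K; field.
  by rewrite !gt_eqF //; lra.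
have boundE (I J : nat) : I%:R <= K * J%:R ->
    eps / 12 * x `^ (- (1 / 2)) * I%:R <= J%:R.
  by move=> le_IJ; rewrite factorE ler_pdivrMl //; lra.
have [n_big|n_small] := leqP (4 * num_edges e) n.
  apply: le_trans (Prob_ge (bad := fun _ _ => false) (delta := 0) eps_gt0 eps_le _ _).
  - by rewrite mulr0 subr0 lerBlDr lerDl divr_ge0 // exprn_ge0.
  - move=> a r _; apply: boundE; have [_ _ _ out] := runP a r.
    set J := output n _ in out *.
    have compl_le : (#|~: J| <= 2 * num_edges e)%N.
      apply: leq_trans (card_nonisolated e).
      (* A removed vertex fails the test or has a neighbour in [J]; an isolated one does neither,
         its score being an empty sum. *)
      apply/subset_leq_card/fintype.subsetP => v; rewrite finset.in_setC => vJ; rewrite inE.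
      have [|[u _ euv]] := out v vJ; last first.
        by apply/existsP; exists u; have [-> _] := e_simple.
      rewrite passes_testE; apply: contraR => /existsPn isolated.
      rewrite /score big_pred0 ?lexx // => u.
      by rewrite inE (negbTE (isolated u)).
    have card_le : (#|Istar| <= 2 * #|J|)%N.
      apply: leq_trans (max_card _) _.
      by apply: half (cardsC J) compl_le _; rewrite card_ord.
    apply: (@le_trans _ _ (2 * #|J|%:R)); last by rewrite ler_wpM2r.
    by rewrite -natrM ler_nat.
  - by move=> v; rewrite big_pred0.
have es_size := size_listing es_listing.
have /andP[L_ge L_le] : 16 * ln n%:R <= log_weight R es <= 576 * ln n%:R.
  by apply: log_weight_bounds; rewrite ?es_size ?m_gt0 ?num_edges_le.
apply: le_trans (Prob_ge (bad := atypical e es Istar eps)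
                         (delta := (n%:R ^+ 2)^-1) eps_gt0 eps_le _ _).
- by rewrite expr1 expr2 invfM mulrA divff ?gt_eqF // div1r.
- move=> a r typical; apply: boundE; have [_ _ pass out] := runP a r.
  set J := output n _ in pass out *.
  apply: (card_dominated (e := e)) => //; first by lra.
    move=> v vJ vI; rewrite ler_pdivlMr //.
    have := typical_out vI (typical v) (pass v vJ).
    (* Dividing [24 * Num.sqrt x] by the [2 * eps] of [typical_out] gives [K]. *)
    have sqrt_le : Num.sqrt (#|nbhd e v|%:R * log_weight R es) <= 24 * Num.sqrt x.
      have -> : 24 * Num.sqrt x = Num.sqrt (24 ^+ 2 * x).
        by rewrite [RHS]sqrtrM ?sqr_ge0 // sqrtr_sqr ger0_norm.
      rewrite ler_wsqrtr // /x [leRHS]mulrCA.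
      apply: ler_pM; rewrite ?log_weight_ge0 ?ler_nat ?deg_le //.
      by apply: le_trans L_le _; rewrite ler_wpM2r //; lra.
    by lra.
  (* A vertex of [Istar] passes the test, so only a neighbour in [J] can have removed it. *)
  move=> v vI vJ; have [|//] := out v vJ.
  by rewrite (typical_in Istar_indep vI (typical v)).
move=> v; apply: le_trans (atypical_prob e es Istar eps_gt0 eps_le v) _.
rewrite -[leRHS]lnK ?posrE ?invr_gt0 ?exprn_gt0 // ler_expR.
by rewrite lnV ?posrE ?exprn_gt0 // lnXn // mulr2n; lra.
Qed.
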